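(* Let $A=(a_1,\ldots,a_n)$ be a distinguished basis (of positive roots) for the $A_n$ root system, and let $D(A)$ be the parking function diagram corresponding to the parking function $\mathbf{in}(A)$, with points $P_1,\ldots,P_n$. For each $k$, start from $P_k$ and go in the direction strictly north-east (direction $(1,1)$) until one first meets (after leaving $P_k$) a point $P_l$ with $l>k$, or the Dyck path of $D(A)$ at a point which is not some $P_l$ with $l<k$, or the $x$-axis. This path starts at $x$-coordinate $\mathbf{in}(a_k)-1$; let $\mathbf{ter}(k)$ be the $x$-coordinate of its end. Then $$a_k=e_{\mathbf{in}(a_k)}+\cdots+e_{\mathbf{ter}(k)}.$$
   Context: Let $e_1,\ldots,e_n$ be the positive simple roots of the $A_n$ root system; the positive roots are $e_{ij}=e_i+\cdots+e_j$, $1\le i\le j\le n$. The Seifert form is the bilinear form on the root lattice with $\langle e_i,e_i\rangle=1$, $\langle e_i,e_{i+1}\rangle=-1$, $\langle e_i,e_j\rangle=0$ for $j\ne i,i+1$. A distinguished basis (of positive roots) is an ordered basis $A=(a_1,\ldots,a_n)$ of the root lattice consisting of positive roots with $\langle a_j,a_i\rangle=0$ for all $j>i$. Put $\mathbf{in}(e_{ij})=i$ and $\mathbf{in}(A)=(\mathbf{in}(a_1),\ldots,\mathbf{in}(a_n))$, which is a parking function, i.e. a function $f:\{1,\ldots,n\}\to\{1,\ldots,n\}$ with $|f^{-1}(\{1,\ldots,k\})|\ge k$ for all $k$. Parking function diagrams: consider Young diagrams in the fourth quadrant inside the triangle bounded by the coordinate axes and the line $y=x-n$; they have rows $r=1,\ldots,n$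 numbered from the top, of lengths $\lambda_1\ge\cdots\ge\lambda_n\ge0$ with $\lambda_r\le n-r$, row $r$ occupying $0\le x\le\lambda_r$, $-r\le y\le -r+1$. The boundary of the diagram is a lattice path (the Dyck path) from $(0,-n)$ to $(n,0)$ with steps $(0,1)$ and $(1,0)$: the vertical step of row $r$ goes from $(\lambda_r,-r)$ to $(\lambda_r,-r+1)$. A parking function diagram is such a diagram with the numbers $1,\ldots,n$ written at the ends of the rows, one per row, such that the numbers in every column (rows with equal $\lambda_r$) increase upwards. $P_k=(\lambda_r,-r)$ is the south-east corner of the row $r$ carrying the number $k$. The diagram $D$ corresponds to the parking function $f_D(k)=\lambda_r+1$, where $r$ is the row carrying $k$; $D\mapsto f_D$ is a bijection between parking function diagrams and parking functions. *)

(* Defs.v *)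
From HB Require Import structures.
From mathcomp Require Import all_boot all_order all_algebra all_fingroup.

Set Implicit Arguments.
Unset Strict Implicit.
Unset Printing Implicit Defensive.

Import Order.TTheory GRing.Theory Num.Theory.
Local Open Scope ring_scope.

(* The root lattice of A_n is 'rV[int]_n, in coordinates with respect to the
   simple roots.  Simple roots are numbered 1..n, as in the literature: the
   coordinate of index k : 'I_n is the coefficient of the simple root k.+1. *)
Definition simple_root (n i : nat) : 'rV[int]_n :=
  \row_(k < n) (k.+1 == i)%:R.

Definition root_sum (n i j : nat) : 'rV[int]_n :=
  \sum_(i <= m < j.+1) simple_root n m.

Definition positive_root (n : nat) (v : 'rV[int]_n) : Prop :=
  exists i j : nat, [/\ (1 <= i)%N, (i <= j)%N, (j <= n)%N & v = root_sum n i j].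

Definition seifert_mx (n : nat) : 'M[int]_n :=
  \matrix_(i < n, j < n)
    (if i == j then 1 else if j == i.+1 :> nat then -1 else 0).

Definition seifert (n : nat) (u v : 'rV[int]_n) : int :=
  (u *m seifert_mx n *m v^T) 0 0.

Definition lattice_basis (n : nat) (A : 'I_n -> 'rV[int]_n) : Prop :=
  forall v : 'rV[int]_n,
    exists! c : 'rV[int]_n, v = \sum_(k < n) c 0 k *: A k.

Definition distinguished_basis (n : nat) (A : 'I_n -> 'rV[int]_n) : Prop :=
  [/\ lattice_basis A,
      forall k : 'I_n, positive_root (A k)
    & forall i j : 'I_n, (i < j)%N -> seifert (A j) (A i) = 0].

(* in(e_{ij}) = i, see root_in_sum; the value 0 is used off positive roots. *)
Definition root_in (n : nat) (v : 'rV[int]_n) : nat :=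
  if [pick ij : 'I_n.+1 * 'I_n.+1 |
       [&& (1 <= ij.1)%N, (ij.1 <= ij.2)%N & v == root_sum n ij.1 ij.2]]
  is Some ij then ij.1 else 0%N.

(* Row numbers and the numbers written in the rows are shifted by one: r : 'I_n
   is the row r.+1 (counted from the top), of length tnth (row_len D) r, and
   the number written in it is (row_label D r).+1. *)
Record parking_diagram (n : nat) := ParkingDiagram {
  row_len : n.-tuple nat;
  row_label : {perm 'I_n};
  row_len_mono : forall r s : 'I_n,
    (r <= s)%N -> (tnth row_len s <= tnth row_len r)%N;
  row_len_bound : forall r : 'I_n, (tnth row_len r <= n - r.+1)%N;
  row_label_mono : forall r s : 'I_n,
    tnth row_len r = tnth row_len s -> (r < s)%N ->
    (row_label s < row_label r)%N
}.

Definition label_row (n : nat) (D : parking_diagram n) (k : 'I_n) : 'I_n :=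
  ((row_label D)^-1)%g k.

Definition diagram_function (n : nat) (D : parking_diagram n) (k : 'I_n) : nat :=
  (tnth (row_len D) (label_row D k)).+1.

Section Plane.

Variables (R : realFieldType) (n : nat) (D : parking_diagram n).

Definition corner (k : 'I_n) : R * R :=
  let r := label_row D k in ((tnth (row_len D) r)%:R, - (r.+1)%:R).

(* The first alternative is the vertical step of the row r.+1; the second is
   the horizontal part at height - r, which runs from the end of the row r.+1
   to the end of the row r, or to (n, 0) when r = 0. *)
Definition dyck_path (p : R * R) : Prop :=
  exists r : 'I_n,
    (p.1 = (tnth (row_len D) r)%:R /\ - (r.+1)%:R <= p.2 <= - r%:R) \/
    (p.2 = - r%:R /\
     (tnth (row_len D) r)%:R <= p.1 <= (nth 0%N (n :: row_len D) r)%:R).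

Definition stops_at (k : 'I_n) (p : R * R) : Prop :=
  [\/ exists2 l : 'I_n, (k < l)%N & p = corner l,
      dyck_path p /\ ~ (exists2 l : 'I_n, (l < k)%N & p = corner l)
    | p.2 = 0].

Definition ray (k : 'I_n) (t : R) : R * R :=
  ((corner k).1 + t, (corner k).2 + t).

Definition ray_end (k : 'I_n) (p : R * R) : Prop :=
  exists t : R, [/\ 0 < t, p = ray k t, stops_at k p
    & forall s : R, 0 < s -> s < t -> ~ stops_at k (ray k s)].

End Plane.

Lemma root_sumE (n i j : nat) (k : 'I_n) :
  root_sum n i j 0 k = (i <= k.+1 <= j)%N%:R.
Proof.
rewrite /root_sum summxE.
under eq_bigr => m _ do rewrite mxE.
case: (boolP (i <= k.+1 <= j)%N) => h.
  rewrite (bigD1_seq k.+1) /= ?iota_uniq ?mem_index_iota ?ltnS //.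
  rewrite eqxx big1 ?addr0 // => m; rewrite eq_sym.
  by move/negbTE->.
rewrite big_seq big1 // => m; rewrite mem_index_iota ltnS => hm.
by case: eqP => // km; rewrite km hm in h.
Qed.

Lemma seifert_simple (n : nat) (i j : 'I_n) :
  seifert (simple_root n i.+1) (simple_root n j.+1) =
  if i == j then 1 else if j == i.+1 :> nat then -1 else 0.
Proof.
have E (k : 'I_n) : simple_root n k.+1 = delta_mx 0 k.
  by apply/rowP => m; rewrite !mxE eqxx eqSS.
by rewrite /seifert !E -rowE trmx_delta -colE !mxE.
Qed.

Lemma root_in_sum (n i j : nat) :
  (1 <= i)%N -> (i <= j)%N -> (j <= n)%N -> root_in (root_sum n i j) = i.
Proof.
move=> i1 ij jn; rewrite /root_in; case: pickP => [[a b] /=|none].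
  case/and3P => a1 ab /eqP/rowP e.
  have an : (a.-1 < n)%N by rewrite prednK // -ltnS.
  have i_n : (i.-1 < n)%N by rewrite prednK // (leq_trans ij).
  have := e (Ordinal an); have := e (Ordinal i_n).
  rewrite !root_sumE /= !prednK // !leqnn ij ab /=.
  case: (leqP a i) => ai /= => [_|/eqP]; last by rewrite oner_eq0.
  case: (leqP i a) => ia /= => [_|/eqP]; last by rewrite eq_sym oner_eq0.
  by apply/eqP; rewrite eqn_leq ai ia.
have lein : (i < n.+1)%N by rewrite ltnS (leq_trans ij).
have := none (Ordinal lein, Ordinal (jn : (j < n.+1)%N)).
by rewrite /= i1 ij eqxx.
Qed.

(* Main.v *)
Require Import Defs.
From mathcomp Require Import all_boot all_order all_algebra all_fingroup.
From mathcomp Require Import zify lra.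

Set Implicit Arguments.
Unset Strict Implicit.
Unset Printing Implicit Defensive.

Import Order.TTheory GRing.Theory Num.Theory.
Local Open Scope ring_scope.

(** Put x = in(a) - 1 and z = j for a root a = e_i + ... + e_j, and read it as
    the chord from x to z on the points 0, ..., n of a line.  The Seifert form
    of two roots only depends on whether the endpoints of the first chord lie
    in the half-open interval [x, z) of the second one
    ([seifert_root_sum]).  A distinguished basis is thus a family of n chords,
    labelled by 0, ..., n - 1, such that both or none of the endpoints of
    every chord lie in the interval of each chord with a smaller label.  This
    makes the chords noncrossing, and linear independence makes them a tree.
    All that is used of the tree are two counts, both consequences of the
    independence of the rows of a matrix: at most q - p chords lie inside
    [p, q] ([card_chords_between]), and at least z - x chords lie inside the
    interval [x, z] spanned by a chord ([card_chords_inside_ge]).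

    On the diagram side, let r be the row of the label k, counted from 0.
    After m unit steps the ray from P_k is at height m - (r + 1) over the
    point X = x_k + m, and just to the left of X the Dyck path is at height
    - h, where h is the number of rows of length at least X.  Hence the ray is
    strictly below the Dyck path as long as m is less than r + 1 - h, and this
    difference is the number of labels in the rows h, ..., r, that is, of the
    chords that start before X and that come after the chord k when they are
    ordered by their starting point and then by their label
    ([card_later_starts_rows]).  Call this number G(X).

    The count in the tree gives G(z_k) = z_k - x_k ([later_starts_end]), so
    the ray touches the path over z_k; no chord with a smaller label starts
    there, hence the ray stops.  For x_k < X < z_k, at least z_k - x_k chords
    lie inside [x_k, z_k], and at most z_k - X of them start at X or later, so
    G(X) is at least X - x_k ([later_starts_ge]): the ray has not
    crossed the path.  If equality holds, then the chords inside [X, z_k] form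
    a spanning tree of that interval; following the longest chords from X, one
    would get stuck before z_k if all chords starting at X had labels larger
    than k ([card_chords_lt]).  So some chord with a smaller label starts at X
    ([later_starts_eq]), which means that the ray touches the path at a point
    P_l with l < k, where it does not stop. *)

(** * Linear algebra *)

(** If each row in [S] is recovered from its entries in the columns of [T] by a
    fixed matrix [P], then the submatrix of the rows [S], whose rank is [#|S|],
    factors through a space of dimension [#|T|]. *)
Lemma card_rows_determined (F : fieldType) n (M P : 'M[F]_n) (S T : {set 'I_n}) :
    M \in unitmx ->
    (forall s b, s \in S -> M s b = \sum_(t in T) M s t * P t b) ->
  (#|S| <= #|T|)%N.
Proof.
move=> uM hP.
pose f (i : 'I_#|S|) : 'I_n := enum_val i.
pose g (i : 'I_#|T|) : 'I_n := enum_val i.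
have rk : \rank (rowsub f M) = #|S|.
  rewrite -[M]mul1mx -mul_rowsub_mx mxrankMfree ?row_free_unit //.
  apply/eqP; rewrite -[_ == _]/(row_free _).
  apply/row_freeP; exists (colsub f 1%:M).
  apply/matrixP => i j; rewrite mulmx_colsub mulmx1 !mxE.
  by rewrite (inj_eq enum_val_inj).
have -> : #|S| = \rank (colsub g (rowsub f M) *m rowsub g P).
  rewrite -[LHS]rk; congr (\rank _); apply/matrixP => i b.
  rewrite !mxE (hP _ _ (enum_valP i)) big_enum_val.
  by apply: eq_bigr => t _; rewrite !mxE.
exact: mulmx_max_rank.
Qed.

(** For the second argument v, the Seifert form is the sum of the differences
    v_m - v_(m+1) over the simple roots e_m in the support of the first, so
    that the sum telescopes. *)
Lemma seifert_root_sum n (x z p q : nat) :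
    (x < z <= n)%N -> (q <= n)%N ->
  seifert (root_sum n x.+1 z) (root_sum n p.+1 q) =
    (p <= x < q)%N%:R - (p <= z < q)%N%:R.
Proof.
move=> /andP[xz zn] qn; pose w c : int := (p <= c < q)%N%:R.
have col (i : 'I_n) :
    (seifert_mx n *m (root_sum n p.+1 q)^T) i 0 = w i - w i.+1.
  rewrite !mxE; under eq_bigr => j _ do rewrite !mxE root_sumE ltnS.
  have [lt_in | ge_in] := ltnP i.+1 n.
    rewrite (bigD1 i) //= eqxx mul1r (bigD1 (Ordinal lt_in)) /=; last first.
      by rewrite -val_eqE /= neq_ltn leqnn orbT.
    rewrite -val_eqE /= eqn_leq ltnn andbF eqxx mulN1r big1 ?addr0 // => j.
    rewrite -!val_eqE /= => /andP[/negbTE ji /negbTE jSi].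
    by rewrite eq_sym ji jSi mul0r.
  rewrite (bigD1 i) //= eqxx mul1r big1 ?addr0 => [|j ji]; last first.
    rewrite eq_sym (negbTE ji) (ltn_eqF (leq_trans (ltn_ord j) ge_in)).
    by rewrite mul0r.
  (* The last row of the Seifert matrix has no entry -1, but w n = 0. *)
  by rewrite /w [(i.+1 < q)%N]ltnNge (leq_trans qn) // andbF subr0.
rewrite /seifert -mulmxA mxE.
under eq_bigr => i _ do rewrite col root_sumE ltnS.
have -> : \sum_(i < n) (x <= i < z)%N%:R * (w i - w i.+1) =
          \sum_(x <= i < z) (w i - w i.+1).
  rewrite (big_nat_widen _ _ n) // (big_nat_widenl _ 0) // big_mkord.
  rewrite [RHS]big_mkcond; apply: eq_bigr => i _ /=.
  by rewrite andbC; case: ifP; rewrite ?mul1r ?mul0r.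
under eq_bigr => i _ do rewrite -opprB.
by rewrite sumrN telescope_sumr ?opprB // ltnW.
Qed.

(** * Labelled noncrossing trees *)

Section LabelledTree.

Variables (n : nat) (x z : 'I_n -> nat).

(** The rows are the roots, in the basis of simple roots: the column [m] stands
    for the simple root [m.+1], that is, for the edge from [m] to [m.+1]. *)
Definition chord_mx : 'M[rat]_n := \matrix_(k, m) (x k <= m < z k)%N%:R.

Hypothesis chordP : forall k, (x k < z k <= n)%N.
Hypothesis separated : forall k l : 'I_n, (k < l)%N ->
  (x k <= x l < z k)%N = (x k <= z l < z k)%N.
Hypothesis free_chords : chord_mx \in unitmx.

Local Open Scope nat_scope.

Lemma card_ord_interval p q :
  p <= q <= n -> #|[set m : 'I_n | p <= m < q]| = q - p.
Proof.
move=> /andP[pq qn]; rewrite -sum1_card.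
under eq_bigl => m do rewrite inE.
transitivity (\sum_(p <= m < q) 1); last by rewrite sum_nat_const_nat muln1.
rewrite (big_nat_widen _ _ n) // (big_nat_widenl _ 0) // big_mkord.
by apply: eq_bigl => m /=; rewrite andbC.
Qed.

(** A forest on the points p, ..., q has at most q - p edges: the roots in
    question are supported in q - p coordinates. *)
Lemma card_chords_between p q :
  p <= q <= n -> #|[set l | (p <= x l) && (z l <= q)]| <= q - p.
Proof.
move=> pqn; rewrite -card_ord_interval //.
apply: (card_rows_determined (P := 1%:M%R) free_chords) => s b.
rewrite inE => /andP[ps sq].
have [bT | bT] := boolP (b \in [set m : 'I_n | p <= m < q]).
  rewrite (bigD1 b) //= [X in (_ * X)%R]mxE eqxx mulr1 big1 ?addr0 // => t.
  by move=> /andP[_ /negbTE tb]; rewrite [X in (_ * X)%R]mxE tb mulr0.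
rewrite big1 => [|t tT]; last first.
  rewrite [X in (_ * X)%R]mxE; case: eqP => [tb|_]; last by rewrite mulr0.
  by rewrite -tb tT in bT.
rewrite mxE; rewrite inE in bT.
by have -> : (x s <= b < z s) = false by lia.
Qed.

Lemma laminar_chords k l :
  [|| (x k <= x l) && (z l <= z k), (x l <= x k) && (z k <= z l),
      z l <= x k | z k <= x l].
Proof.
have := chordP k; have := chordP l.
have [kl|lk|/val_inj ->] := ltngtP k l; last by rewrite !leqnn.
  by have := separated kl; lia.
by have := separated lk; lia.
Qed.

(** By [laminar_chords], the interval of a chord that is not inside
    the chord [k] contains the one of [k] or is disjoint from it.  So these
    roots, and the root [k] itself, are constant on the support of [k]: they
    lie in a space of dimension n - (z k - x k) + 1, where all coordinates of
    that support can be read off its first column. *)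
Lemma card_chords_inside_ge k :
  z k - x k <= #|[set l | (x k <= x l) && (z l <= z k)]|.
Proof.
set I := [set l | _]; have /andP[xz zn] := chordP k.
have xn : x k < n by apply: leq_trans zn.
pose T := ~: [set m : 'I_n | (x k).+1 <= m < z k].
pose r (b : 'I_n) := if b \in T then b else Ordinal xn.
have cT : #|T| = n - (z k - (x k).+1).
  by rewrite cardsCs card_ord setCK card_ord_interval ?xz.
have kI : k \in I by rewrite inE !leqnn.
have cS : #|k |: ~: I| = (n - #|I|).+1.
  by rewrite cardsU1 inE kI add1n cardsCs card_ord setCK.
have rT b : r b \in T.
  by rewrite /r; case: ifP => // _; rewrite !inE /= ltnn.
have : #|k |: ~: I| <= #|T|.
  apply: (card_rows_determined (P := (\matrix_(t, b) (t == r b)%:R)%R)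
    free_chords) => s b sS.
  rewrite (bigD1 (r b)) //= [X in (_ * X)%R]mxE eqxx mulr1.
  rewrite big1 ?addr0 => [|t /andP[_ /negbTE tb]]; last first.
    by rewrite [X in (_ * X)%R]mxE tb mulr0.
  rewrite !mxE /r; case: ifP => // /negbT; rewrite !inE negbK /= => bI.
  congr (nat_of_bool _)%:R%R.
  have := laminar_chords k s; have := chordP s.
  by move: sS; rewrite !inE => /orP[/eqP->|]; lia.
have := subset_leq_card (subsetT I); rewrite cardsT card_ord cT cS.
by lia.
Qed.

Lemma start_neq_end (k l : 'I_n) : k <= l -> x k != z l.
Proof.
rewrite leq_eqVlt => /orP[/eqP/val_inj->|kl]; first by have := chordP l; lia.
by have := separated kl; have := chordP k; have := chordP l; lia.
Qed.

(** If all chords from [X] have labels larger than [k], then the chords between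
    [X] and [z k] do not connect these two points.  If a chord starts at [X],
    let W be the end of the longest one.  Then W < [z k] because of its label,
    and each chord between [X] and [z k] is between [X] and W or between W and
    [z k].  By [start_neq_end] all chords from W have labels larger than [k] as
    well, so that the induction hypothesis applies to W. *)
Lemma card_chords_lt (k : 'I_n) X :
    x k < X < z k -> (forall l, x l = X -> k < l) ->
  #|[set l | (X <= x l) && (z l <= z k)]| < z k - X.
Proof.
have /andP[xz zn] := chordP k.
move: {2}(z k - X) (leqnn (z k - X)) => m; elim: m X => [|m IH] X; first by lia.
move=> Xm kX after; have [l0 /eqP l0X | none] := pickP (fun l => x l == X).
  case: (@arg_maxnP _ l0 (fun l => x l == X) z); first exact/eqP.
  move=> l /eqP lX lmax; pose W := z l.
  have kl := after l lX.
  have Wk : X < W < z k.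
    by have := separated kl; have := chordP l; rewrite /W; lia.
  have Wafter m' : x m' = W -> k < m'.
    move=> m'W; apply: leq_trans kl _; rewrite leqNgt; apply/negP => /ltnW m'l.
    by have := start_neq_end m'l; rewrite m'W eqxx.
  have FW : #|[set l | (W <= x l) && (z l <= z k)]| < z k - W.
    by apply: IH => //; lia.
  have FX : #|[set l | (X <= x l) && (z l <= W)]| <= W - X.
    by apply: card_chords_between; lia.
  have : #|[set l | (X <= x l) && (z l <= z k)]| <=
         #|[set l | (X <= x l) && (z l <= W)]
           :|: [set l | (W <= x l) && (z l <= z k)]|.
    apply/subset_leq_card/subsetP => i; rewrite !inE => /andP[Xi iz].
    rewrite Xi iz andbT; have [iX|iX] := eqVneq (x i) X.
      by have /= -> := lmax i (introT eqP iX).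
    by have := laminar_chords l i; rewrite /W; lia.
  move/leq_trans/(_ (leq_card_setU _ _)); lia.
have : #|[set l | (X.+1 <= x l) && (z l <= z k)]| <= z k - X.+1.
  by apply: card_chords_between; lia.
suff -> : [set l | (X <= x l) && (z l <= z k)] =
          [set l | (X.+1 <= x l) && (z l <= z k)] by lia.
by apply/setP => i; rewrite !inE ltn_neqAle eq_sym none.
Qed.

(** The chords that start to the left of [X] and are not before [k] in the
    lexicographic order on pairs of a starting point and a label. *)
Definition later_starts (k : 'I_n) (X : nat) : {set 'I_n} :=
  [set l | ((x k < x l) || (x k == x l) && (k <= l)) && (x l < X)].

(** Both sides count the chords between [x k] and [z k], split on the right
    according to whether they start before [X].  Among the chords that start
    at [x k], those with a label smaller than [k] end after [z k], the others
    do not. *)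
Lemma card_later_starts (k : 'I_n) X : x k < X <= z k ->
  z k - x k = #|later_starts k X| + #|[set l | (X <= x l) && (z l <= z k)]|.
Proof.
move=> kX; have /andP[xz zn] := chordP k.
set F := [set l | (X <= _) && _].
have dis : [disjoint later_starts k X & F].
  by apply/pred0P => l /=; rewrite !inE; lia.
have -> : #|later_starts k X| + #|F| = #|later_starts k X :|: F|.
  by apply/eqP; rewrite eq_sym (leq_card_setU _ _).2.
have -> : later_starts k X :|: F = [set l | (x k <= x l) && (z l <= z k)].
  apply/setP => l; rewrite !inE; have := chordP l.
  have [kl|lk|/val_inj <-] := ltngtP k l; last by lia.
    by have := separated kl; lia.
  by have := separated lk; lia.
apply/eqP; rewrite eqn_leq card_chords_inside_ge.
by apply: card_chords_between; lia.
Qed.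

Lemma later_starts_end k : #|later_starts k (z k)| = z k - x k.
Proof.
have /andP[xz zn] := chordP k.
have := @card_chords_between (z k) (z k); rewrite leqnn zn subnn => /(_ isT).
by have := @card_later_starts k (z k); lia.
Qed.

Lemma later_starts_ge k X : x k < X < z k -> X - x k <= #|later_starts k X|.
Proof.
move=> kX; have /andP[xz zn] := chordP k.
have := @card_later_starts k X; have := @card_chords_between X (z k).
by lia.
Qed.

Lemma later_starts_eq (k : 'I_n) X :
    x k < X < z k -> #|later_starts k X| = X - x k ->
  exists2 l : 'I_n, l < k & x l = X.
Proof.
move=> kX e; have [l /andP[lk /eqP lX] | none] :=
  pickP (fun l : 'I_n => (l < k) && (x l == X)); first by exists l.
have := @card_chords_lt k X kX; have := @card_later_starts k X.
have after l : x l = X -> k < l.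
  move=> lX; have := none l; rewrite lX eqxx andbT => /negbT; rewrite -leqNgt.
  by rewrite leq_eqVlt => /orP[/eqP/val_inj kl|//]; move: kX; rewrite kl lX; lia.
by move=> c /(_ after); lia.
Qed.

End LabelledTree.

(** * Rows of a parking function diagram *)

Section Diagram.

Variables (n : nat) (D : parking_diagram n).

Local Notation len r := (tnth (row_len D) r).
Local Notation row := (label_row D).

Definition label_column (k : 'I_n) : nat := len (row k).

Definition long_rows (X : nat) : nat := #|[set r : 'I_n | (X <= len r)%N]|.

Lemma label_rowK : cancel row (row_label D).
Proof. by move=> k; rewrite /label_row permKV. Qed.

Lemma row_labelK : cancel (row_label D) row.
Proof. by move=> r; rewrite /label_row permK. Qed.

(** The rows get shorter downwards, so the long ones come first. *)
Lemma long_rowsP X (r : 'I_n) : (X <= len r)%N = (r < long_rows X)%N.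
Proof.
have rn := ltn_ord r.
have [Xr | rX] := leqP X (len r); apply/esym.
  rewrite -[r.+1]subn0 -(@card_ord_interval n 0 r.+1) //.
  apply/subset_leq_card/subsetP => s; rewrite !inE /= ltnS => sr.
  by apply: leq_trans Xr _; apply: row_len_mono.
apply/negbTE; rewrite -leqNgt.
have <- : #|[set s : 'I_n | (0 <= s < r)%N]| = r.
  by rewrite card_ord_interval ?subn0 ?(ltnW rn).
apply/subset_leq_card/subsetP => s; rewrite !inE /= => Xs.
rewrite ltnNge; apply/negP => /(row_len_mono D) sr.
by have := leq_trans Xs sr; rewrite leqNgt rX.
Qed.

(** From the bottom row to the top one, the labels are sorted by their column
    and, within a column, by their value. *)
Lemma row_leP (k l : 'I_n) :
  ((label_column k < label_column l) ||
   (label_column k == label_column l) && (k <= l))%N = (row l <= row k)%N.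
Proof.
rewrite /label_column; have [lk | kl | /val_inj e] := ltngtP (row l) (row k).
- rewrite leq_eqVlt eq_sym.
  have := @row_label_mono n D (row l) (row k); have := row_len_mono D (ltnW lk).
  by rewrite !label_rowK; lia.
- have := @row_label_mono n D (row k) (row l); have := row_len_mono D (ltnW kl).
  by rewrite !label_rowK; lia.
- by rewrite (can_inj label_rowK e) eqxx !leqnn orbT.
Qed.

Lemma long_rows_le (k : 'I_n) X : (label_column k < X)%N -> (long_rows X <= row k)%N.
Proof. by rewrite [(long_rows X <= _)%N]leqNgt -long_rowsP -ltnNge. Qed.

Lemma card_later_starts_rows (k : 'I_n) X : (label_column k < X)%N ->
  #|later_starts label_column k X| = ((row k).+1 - long_rows X)%N.
Proof.
move=> kX; have hr := long_rows_le kX.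
rewrite -(@card_ord_interval n) ?ltn_ord ?(leq_trans hr) //.
rewrite -(card_preimset _ (can_inj label_rowK)); congr #|pred_of_set _|.
apply/setP => l.
by rewrite !inE row_leP ltnS andbC [in LHS]ltnNge long_rowsP -leqNgt.
Qed.

(** The lowest point P_m of a nonempty column is the point at which the Dyck
    path arrives from the left. *)
Lemma lowest_long_row (k l : 'I_n) : (l < k)%N ->
  exists2 m : 'I_n, (m < k)%N &
    label_column m = label_column l /\ (row m).+1 = long_rows (label_column l).
Proof.
move=> lk; set X := label_column l; set h := long_rows X.
have lh : (row l < h)%N by rewrite -long_rowsP.
have hn : (h.-1 < n)%N.
  rewrite prednK ?(leq_ltn_trans _ lh) //.
  by rewrite -[n in leqRHS]card_ord max_card.
pose s := Ordinal hn; exists (row_label D s).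
  apply: leq_ltn_trans lk; have := row_leP (row_label D s) l.
  have : (X <= len s)%N by rewrite long_rowsP -/h /= prednK // (leq_ltn_trans _ lh).
  rewrite /label_column row_labelK /=.
  have : (len s <= len (row l))%N by apply: row_len_mono => /=; lia.
  by rewrite -/(label_column l) -/X; lia.
split; last by rewrite row_labelK /=; lia.
apply/eqP; rewrite /label_column row_labelK eqn_leq long_rowsP -/X -/h /=.
by rewrite row_len_mono /=; lia.
Qed.

(** * The ray and the Dyck path *)

Section Ray.

Variable R : realFieldType.

Lemma addr_nat_eq (a b : nat) (t : R) :
  0 <= t -> a%:R + t = b%:R -> (a <= b)%N /\ t = (b - a)%N%:R.
Proof.
move=> t0 e; have ab : (a <= b)%N by rewrite -(ler_nat R) -e lerDl.
by split=> //; rewrite natrB // -e addrAC subrr add0r.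
Qed.

Lemma corner_inj : injective (@corner R n D).
Proof.
move=> k l [_ /oppr_inj/eqP]; rewrite eqr_nat eqSS => /eqP/val_inj.
exact: (can_inj label_rowK).
Qed.

(** The ray can stop only on or above the Dyck path.  The path has integral
    vertices and the ray has slope 1, so this happens over an integral point
    [label_column k + m]; just to the left of it the path is at height
    - long_rows (label_column k + m). *)
Lemma stops_at_above (k : 'I_n) (t : R) : 0 <= t -> stops_at D k (ray D k t) ->
  exists m : nat, [/\ t = m%:R, (m <= (row k).+1)%N &
    ((row k).+1 <= m + long_rows (label_column k + m))%N].
Proof.
move=> t0.
have yE s : (ray D k t).2 = - s%:R -> (s <= (row k).+1)%N /\
    t = ((row k).+1 - s)%N%:R.
  rewrite /ray /= => e; apply: addr_nat_eq => //.
  by move/eqP: e; lra.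
have xE s : (ray D k t).1 = (s%:R) -> (label_column k <= s)%N /\
    t = (s - label_column k)%N%:R by move=> /(addr_nat_eq t0).
case=> [[l kl el] | [[s [[e /andP[y1 y2]] | [e /andP[x1 x2]]]] _] | e].
- have [|le tE] := yE (row l).+1; first by rewrite el.
  have [|le' tE'] := xE (label_column l); first by rewrite el.
  exists ((row k).+1 - (row l).+1)%N; split=> //; first exact: leq_subr.
  have /eqP := tE; rewrite tE' eqr_nat => /eqP <-.
  have : (row l < long_rows (label_column l))%N by rewrite -long_rowsP.
  by rewrite subnKC //; move/eqP: tE'; rewrite tE eqr_nat; lia.
- have [le tE] := xE _ e; exists (len s - label_column k)%N.
  have sh : (s < long_rows (len s))%N by rewrite -long_rowsP.
  move: y1 y2; rewrite /ray /= tE subnKC // => y1 y2.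
  have : (len s - label_column k + s <= (row k).+1)%N.
    by rewrite -(ler_nat R) natrD; lra.
  have : ((row k).+1 <= len s - label_column k + s.+1)%N.
    by rewrite -(ler_nat R) natrD; lra.
  by split=> //; lia.
- have [le tE] := yE _ e; exists ((row k).+1 - s)%N; split=> //.
    exact: leq_subr.
  suff : (s <= long_rows (label_column k + ((row k).+1 - s)))%N by lia.
  move: x2; rewrite /ray /= tE -natrD ler_nat -/(label_column k).
  case: (val s) (ltn_ord s) => //= s' ltsn.
  by rewrite -(tnth_nth 0%N (row_len D) (Ordinal (ltnW ltsn))) long_rowsP.
- have [|_ tE] := yE 0%N; first by rewrite e oppr0.
  by exists (row k).+1; rewrite tE subn0; split=> //; apply: leq_addr.
Qed.

(** Before [Z] the ray is below the Dyck path, except that it may touch the path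
    at the lowest point of a column that contains a label [l] with [l < k];
    that point carries the least label of its column, so it is no stop.  At
    [Z] the ray meets the end of the horizontal part of the path at height
    - long_rows Z. *)
Lemma ray_end_label (k : 'I_n) (Z : nat) :
    (label_column k < Z <= n)%N ->
    #|later_starts label_column k Z| = (Z - label_column k)%N ->
    (forall l : 'I_n, (l < k)%N -> label_column l != Z) ->
    (forall X, (label_column k < X < Z)%N ->
       (X - label_column k <= #|later_starts label_column k X|)%N /\
       (#|later_starts label_column k X| = (X - label_column k)%N ->
        exists2 l : 'I_n, (l < k)%N & label_column l = X)) ->
  ray_end D k (ray D k (Z - label_column k)%N%:R : R * R).
Proof.
move=> /andP[kZ Zn] cZ notZ before.
have hZ := long_rows_le kZ; rewrite card_later_starts_rows // in cZ.
exists (Z - label_column k)%N%:R; split=> //; first by rewrite ltr0n subn_gt0.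
  apply: Or32; split; last first.
    case=> l lk [e _]; have /negP := notZ l lk; apply.
    rewrite -(eqr_nat R) /label_column -e -natrD subnKC //; exact: ltnW.
  have hn : (long_rows Z < n)%N by apply: leq_ltn_trans hZ _.
  exists (Ordinal hn); right; split=> /=.
    rewrite -cZ natrB; last exact: leqW.
    by rewrite addrA addNr add0r.
  rewrite -natrD -/(label_column k) subnKC; last exact: ltnW.
  rewrite !ler_nat; apply/andP; split.
    by apply: ltnW; rewrite ltnNge long_rowsP ltnn.
  have := long_rowsP Z; case: (long_rows Z) hn => //= h hn /(_ (Ordinal (ltnW hn))).
  by rewrite (tnth_nth 0%N) /= leqnn.
move=> t t0 tZ /[dup] st /(stops_at_above (ltW t0)) [m [tm mr mh]].
have m0 : (0 < m)%N by rewrite -(ltr0n R) -tm.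
have mZ : (m < Z - label_column k)%N by rewrite -(ltr_nat R) -tm.
set X := (label_column k + m)%N in mh.
have kX : (label_column k < X < Z)%N by lia.
have [ge eq] := before X kX; move: ge eq.
rewrite card_later_starts_rows; last by case/andP: kX.
rewrite addKn => ge [|l lk lX]; first by lia.
have [p pk [pX ph]] := lowest_long_row lk.
rewrite lX in pX ph.
have hm : (long_rows X + m = (row k).+1)%N by lia.
have cp : ray D k t = corner R D p.
  rewrite /ray /corner /= -/(label_column p) pX ph tm -/(label_column k) -natrD.
  by congr pair; rewrite -hm addnC natrD opprD addrAC addNr add0r.
case: st => [[q kq] | [_ []] | ].
- by rewrite cp => /corner_inj pq; rewrite pq ltnNge ltnW in pk.
- by exists p.
- by rewrite cp /= => /eqP; rewrite oppr_eq0 pnatr_eq0.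
Qed.

End Ray.
End Diagram.

(** * Distinguished bases *)

Lemma basis_chord_mx_unit n (A : 'I_n -> 'rV[int]_n) (x z : 'I_n -> nat) :
    lattice_basis A -> (forall k, A k = root_sum n (x k).+1 (z k)) ->
  chord_mx x z \in unitmx.
Proof.
move=> basisA rootA.
have /fin_all_exists[c cP] (i : 'I_n) :
    exists c : 'rV[int]_n, delta_mx 0 i = \sum_k c 0 k *: A k.
  by have [c [cP _]] := basisA (delta_mx 0 i); exists c.
pose C : 'M[rat]_n := \matrix_(i, k) (c i 0 k)%:~R.
suff /mulmx1_unit[] : C *m chord_mx x z = 1%:M by [].
apply/matrixP => i m.
have /(congr1 (fun v : 'rV[int]_n => (v 0 m)%:~R : rat)) := cP i.
rewrite [X in X%:~R = _]mxE eqxx summxE rmorph_sum => e.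
rewrite !mxE; transitivity ((m == i)%:R%:~R : rat); last first.
  by rewrite eq_sym; case: (_ == _).
rewrite [RHS]e; apply: eq_bigr => l _.
rewrite !mxE rootA root_sumE ltnS rmorphM.
by case: (_ <= _ < _)%N.
Qed.

Theorem theorem3p9 (R : realFieldType) (n : nat) (A : 'I_n -> 'rV[int]_n)
  (hA : distinguished_basis A)
  (D : parking_diagram n)
  (hD : forall k : 'I_n, diagram_function D k = root_in (A k))
  (k : 'I_n) :
  exists (ter : nat) (y : R),
    ray_end D k (ter%:R, y) /\
    A k = \sum_(root_in (A k) <= m < ter.+1) simple_root n m.
Proof.
case: hA => basisA rootA sepA; pose x := label_column D.
have /fin_all_exists[z zP] (l : 'I_n) : exists j : nat,
    (x l < j <= n)%N /\ A l = root_sum n (x l).+1 j.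
  have [i [j [i1 ij jn Al]]] := rootA l; exists j.
  have -> : (x l).+1 = i by rewrite [LHS]hD Al root_in_sum.
  by rewrite ij jn.
have chordP l : (x l < z l <= n)%N := (zP l).1.
have sep (i j : 'I_n) : (i < j)%N ->
    (x i <= x j < z i)%N = (x i <= z j < z i)%N.
  move=> /sepA; rewrite (zP i).2 (zP j).2 seifert_root_sum //; last first.
    by case/andP: (chordP i).
  by move/eqP; rewrite subr_eq0 eqr_nat; do 2!case: (_ <= _ < _)%N.
have unitA : chord_mx x z \in unitmx.
  by apply: basis_chord_mx_unit basisA _ => l; apply: (zP l).2.
exists (z k), (- (label_row D k).+1%:R + (z k - x k)%N%:R); split; last first.
  by rewrite -hD [LHS](zP k).2.
have -> : (z k)%:R = (x k)%:R + (z k - x k)%N%:R :> R.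
  by rewrite -natrD subnKC //; case/andP: (chordP k) => /ltnW.
apply: ray_end_label => // [||X kX].
- exact: later_starts_end.
- by move=> l /ltnW; apply: (start_neq_end chordP sep).
- by split; [apply: later_starts_ge kX | apply: later_starts_eq kX].
Qed.
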